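(* Fix any pot function $\sigma$, let $f(x)=\int_0^x \frac{1}{\sigma(-\tau)}\,d\tau$ with inverse $f^{-1}$, and let $R(n,k)$ be the highest possible Elo rating achievable with $k$ games and $n$ players, all starting with $0$ Elo points. Then $$\frac12 f^{-1}(2k)\le R(2,k)\le \frac12 f^{-1}(2k-2)+\frac52 .$$ Now assume that $\sup_{z} z\,\sigma(-z)<\infty$, and fix $n=h(k)$, i.e. let the number of players be a function of the number of games. (i) If $h(k)=\Omega(k^{1/3})$, then there exist constants $C_1,C_2>0$ such that for all sufficiently large $k$, $$C_1\,k^{1/3}\le R(h(k),k)\le C_2\,k^{1/3}\,f^{-1}(k)^{1/3}.$$ (ii) Furthermore, if $h(k)=o(k^{1/3})$, then there exist constants $C_1,C_2>0$ such that for all sufficiently large $k$, $$C_1\,h(k)\le R(h(k),k)\le C_2\,h(k)\,f^{-1}\bigl(k/h(k)\bigr).$$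
   Context: A pot function is a function $\sigma:\mathbb{R}\to\mathbb{R}$ that is non-negative and monotonically (not necessarily strictly) increasing and satisfies $\sigma(z)+\sigma(-z)=1$ for all $z\in\mathbb{R}$. Elo system (with pot size $1$): each of $n\ge 2$ players has a real-valued rating (negative and fractional ratings are allowed). In one game, two distinct players $A,B$ with current ratings $r_A,r_B$ play, and their ratings are updated as follows; all other ratings are unchanged. - If $A$ wins: $r_A'=r_A+\sigma(r_B-r_A)$ and $r_B'=r_B-\sigma(r_B-r_A)$. - If $B$ wins: $r_A'=r_A-\sigma(r_A-r_B)$ and $r_B'=r_B+\sigma(r_A-r_B)$. - If they draw: $r_A'=r_A+\frac12\bigl(\sigma(r_B-r_A)-\sigma(r_A-r_B)\bigr)$ and $r_B'=r_B+\frac12\bigl(\sigma(r_A-r_B)-\sigma(r_B-r_A)\bigr)$. Games are played one after another, with ratings updated after each game. $R(n,k)$ is the maximum, over all choices of the pairs of players and of the outcomes in a sequence of $k$ games (all $n$ players starting with rating $0$), of the largest rating held by a player after the $k$ games. The function $h$ takes integer values $\ge 2$, and asymptotic notation refers to $k\to\infty$. The function $f$ is defined on $\{x\in\mathbb{R}:\sigma(-x)>0\}$ (for $x<0$ the integral is the oriented integral). It is continuous and strictly increasing, and its range is all of $\mathbb{R}$, so for any $\sigma$ it has a well-defined inverse $f^{-1}$ defined on all of $\mathbb{R}$. The constants $C_1,C_2$ do not depend on $k$.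
   Formalization: The theorem is stated for pot functions σ for which f has range all of ℝ, so that f⁻¹ exists on ℝ; this fails for some pot functions, e.g. the 0, 1/2, 1 step function, where f⁻¹(2k) is undefined. *)

(* Defs.v *)
From HB Require Import structures.
From mathcomp Require Import all_boot all_order all_algebra.
From mathcomp Require Import all_classical all_reals all_analysis.

Set Implicit Arguments.
Unset Strict Implicit.
Unset Printing Implicit Defensive.

Import Order.TTheory GRing.Theory Num.Theory.
Import numFieldNormedType.Exports.

Local Open Scope classical_set_scope.
Local Open Scope ring_scope.

Definition pot_function (R : realType) (sigma : R -> R) : Prop :=
  [/\ forall z, 0 <= sigma z,
      {homo sigma : x y / x <= y}
    & forall z, sigma z + sigma (- z) = 1].

Inductive outcome := FirstWins | SecondWins | Draw.

Record game (n : nat) := Game {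
  first : 'I_n;
  second : 'I_n;
  first_neq_second : first != second;
  result : outcome }.

Section Elo.
Variables (R : realType) (sigma : R -> R).

Definition gain_first (o : outcome) (rA rB : R) : R :=
  match o with
  | FirstWins => sigma (rB - rA)
  | SecondWins => - sigma (rA - rB)
  | Draw => 2^-1 * (sigma (rB - rA) - sigma (rA - rB))
  end.

Definition gain_second (o : outcome) (rA rB : R) : R :=
  match o with
  | FirstWins => - sigma (rB - rA)
  | SecondWins => sigma (rA - rB)
  | Draw => 2^-1 * (sigma (rA - rB) - sigma (rB - rA))
  end.

Definition play n (r : {ffun 'I_n -> R}) (g : game n) : {ffun 'I_n -> R} :=
  let rA := r (first g) in
  let rB := r (second g) in
  [ffun i => if i == first g then rA + gain_first (result g) rA rB
             else if i == second g then rB + gain_second (result g) rA rB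
             else r i].

Definition final_ratings n (gs : seq (game n)) : {ffun 'I_n -> R} :=
  foldl (@play n) [ffun=> 0] gs.

(* For 2 <= n this set is finite and nonempty (finitely many sequences of k
   games between n players), so its supremum is its maximum. *)
Definition max_rating (n k : nat) : R :=
  sup [set x | exists (gs : seq (game n)) (i : 'I_n),
                 size gs = k /\ x = final_ratings gs i].

Definition pot_dom : set R := [set x | 0 < sigma (- x)].

(* The oriented integral of 1 / sigma (- t) from 0 to x; only the values at
   x in pot_dom are meaningful. *)
Definition pot_integral (x : R) : R :=
  if 0 <= x
  then \int[lebesgue_measure]_(t in `[0, x]) (sigma (- t))^-1
  else - \int[lebesgue_measure]_(t in `[x, 0]) (sigma (- t))^-1.

(* finv is the two-sided inverse of pot_integral : pot_dom -> R; such a finv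
   exists exactly when the range of pot_integral on pot_dom is all of R. *)
Definition pot_inverse (finv : R -> R) : Prop :=
  [/\ forall y, pot_dom (finv y),
      {in pot_dom, cancel pot_integral finv}
    & cancel finv pot_integral].

End Elo.

(* Main.v *)
Require Import Defs.
From HB Require Import structures.
From mathcomp Require Import all_boot all_order all_algebra.
From mathcomp Require Import all_classical all_reals all_analysis.
From mathcomp Require Import lra ring zify.
Import Order.TTheory GRing.Theory Num.Theory.
Import numFieldNormedType.Exports.
Local Open Scope classical_set_scope.
Local Open Scope ring_scope.

Set Implicit Arguments.
Unset Strict Implicit.
Unset Printing Implicit Defensive.

(** Write f for the integral of 1 / sigma(-t) from 0.  Besides f 0 = 0, all that
is used of it is the two-sided bound
[(b - a) / sigma (- a) <= f b - f a <= (b - a) / sigma (- b)] for a <= b in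
its domain ([pot_integral_bounds]), which holds because the integrand is
nondecreasing.  All that is used of a game, in the upper bounds, is that it
transfers some t from a player B to a player A with
[0 <= t <= sigma (- (r A - r B))] ([play_fair]).

Two players.  Their ratings are opposite, so let x be the difference between
them.  If the higher-rated player always wins then x becomes
x + 2 sigma(-x), and f x grows by at least 2 at each game, or else x leaves
the domain of f and exceeds all values of its inverse.  Conversely f (x - 5)
grows by at most 2: as the step is at most 2, the new argument of f is still
below the old x, so the integrand is at most 1 / sigma(-x) over the step.

More players, upper bounds ([barrier]).  The idea is a maximum principle.  Let
S_j be the largest sum of j ratings, and P a parabola with P_0 = 0 and
second difference -G.  If S_j - P_j is maximal after a game at an index
0 < j < m, and the game increased S_j, then the winner A belongs to the
optimal set of j players and the loser B does not; comparing with the indices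
j - 1 and j + 1 shows that A is now at least G above B.  As a transfer is at
most 1, A was already at least G - 2 above B, so that the game transferred at
most sigma(2 - G).  Hence S_j <= P_j + k sigma(2 - G) after k
games, as soon as S_m <= P_m is known by other means.
- With m = n players S_n = 0, and G = 2 + f^-1(k / n) gives a bound of order
  n f^-1(k / n) ([max_rating_le_players]).
- If z sigma(-z) <= M then a game increases the sum of the squares of the
  ratings by at most 2 M + 2, which bounds S_m by a multiple of sqrt(m k).
  With a = f^-1(k), G = a + 2 and m close to (k / a^2)^(1/3), all
  contributions are of order (k a)^(1/3) ([max_rating_le_games]).

More players, lower bounds ([max_rating_ge]).  Since sigma 0 = 1/2, a game
between players of equal rating moves one of them up by 1/2 and the other one
down by 1/2: this is chip-firing on a line.  Among 2 l players whose doubled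
ratings are all less than l in absolute value, two have the same rating, so
such a game is possible, and it increases the sum of the squares of the
doubled ratings by 2.  This sum being then at most 2 l (l - 1)^2, after at
most l^3 games some doubled rating is at least l in absolute value; if it is
negative, all results are reversed.  So 2 l players and l^3 games suffice to
reach the rating l / 2. *)

(** * Integrals of monotone functions *)

Lemma integrable_nondecreasing (R : realType) (g : R -> R) (a b : R) :
  {in `[a, b] &, {homo g : x y / x <= y}} ->
  lebesgue_measure.-integrable `[a, b] (EFin \o g).
Proof.
move=> g_homo.
have [leab|ltba] := leP a b; last first.
  by rewrite set_itv_ge ?integrable_set0 // bnd_simp -ltNge.
(* g is only monotone on [a, b], so it is replaced by g \o clamp, which is
   monotone everywhere, hence measurable. *)
pose clamp x := Num.max a (Num.min b x).
have clampI x : clamp x \in `[a, b].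
  by rewrite in_itv/= le_max lexx/= ge_max leab ge_min lexx.
have clamp_homo : {homo clamp : x y / x <= y}.
  by move=> x y xy; rewrite /clamp ge_max !le_max lexx/= le_min !ge_min lexx xy !orbT.
apply: (@eq_integrable _ _ _ lebesgue_measure _ _ (EFin \o (g \o clamp))) => //.
  move=> x; rewrite inE/= in_itv/= => /andP[ax xb].
  by rewrite /= /clamp (min_r xb) (max_r ax).
apply: measurable_bounded_integrable => //.
- by rewrite /= lebesgue_measure_itv/=; case: ifP => // _; rewrite ltry.
- apply: measurable_realfun.nondecreasing_measurable => // x y xy.
  by apply: g_homo => //; exact: clamp_homo.
- exists (Num.max `|g a| `|g b|); split; first exact: num_real.
  move=> M; rewrite gt_max => /andP[aM bM] x _ /=.
  have ga : g a <= g (clamp x).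
    by apply: g_homo => //; [rewrite in_itv/= lexx leab|have /itvP -> := clampI x].
  have gb : g (clamp x) <= g b.
    by apply: g_homo => //; [rewrite in_itv/= lexx leab|have /itvP -> := clampI x].
  rewrite ler_norml; have := ler_norm (g b); have := ler_norm (- g a).
  by rewrite normrN; lra.
Qed.

Lemma Rintegral_nondecreasing_bounds (R : realType) (g : R -> R) (a b : R) :
  a <= b -> {in `[a, b] &, {homo g : x y / x <= y}} ->
  g a * (b - a) <= \int[lebesgue_measure]_(t in `[a, b]) g t <= g b * (b - a).
Proof.
move=> leab g_homo.
have len : fine (lebesgue_measure `[a, b]) = b - a.
  rewrite /= lebesgue_measure_itv/= lte_fin; case: ltgtP leab => //= -> _.
  by rewrite subrr.
have cst_int c : lebesgue_measure.-integrable `[a, b] (EFin \o (fun=> c)).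
  by apply: integrable_nondecreasing.
have g_int := integrable_nondecreasing g_homo.
rewrite -len -!(@Rintegral_cst _ _ _ lebesgue_measure `[a, b])//.
apply/andP; split; apply: le_Rintegral => //= x; rewrite in_itv/= => /andP[ax xb].
  by apply: g_homo => //; rewrite in_itv/= ?lexx ?leab ?ax ?xb.
by apply: g_homo => //; rewrite in_itv/= ?lexx ?leab ?ax ?xb.
Qed.

Lemma Rintegral_split (R : realType) (g : R -> R) (a b c : R) :
  a <= b -> b <= c -> {in `[a, c] &, {homo g : x y / x <= y}} ->
  \int[lebesgue_measure]_(t in `[a, c]) g t
  = \int[lebesgue_measure]_(t in `[a, b]) g t
    + \int[lebesgue_measure]_(t in `[b, c]) g t.
Proof.
move=> leab lebc g_homo.
have := @Rintegral_itvB R g (BLeft a) (BRight c) b (integrable_nondecreasing g_homo).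
rewrite !bnd_simp => /(_ leab lebc) e.
rewrite -(@Rintegral_itv_obnd_cbnd _ b) -?e; first by rewrite addrC subrK.
apply: (@integrableS _ _ _ lebesgue_measure [set` `[a, c]]) => //.
  by move=> x /=; rewrite !in_itv/= => /andP[bx ->]; rewrite (le_trans leab (ltW bx)).
exact: integrable_nondecreasing.
Qed.

(** * Pot functions and the function f *)

Section PotFunction.
Variables (R : realType) (sigma : R -> R).
Hypothesis sigma_pot : pot_function sigma.

Lemma pot_ge0 z : 0 <= sigma z. Proof. by case: sigma_pot. Qed.
Lemma pot_homo : {homo sigma : x y / x <= y}. Proof. by case: sigma_pot. Qed.
Lemma potN z : sigma (- z) = 1 - sigma z.
Proof. by case: sigma_pot => _ _ /(_ z); lra. Qed.
Lemma pot_le1 z : sigma z <= 1.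
Proof. by have := pot_ge0 (- z); rewrite potN; lra. Qed.
Lemma pot0 : sigma 0 = 2^-1.
Proof. by have := potN 0; rewrite oppr0; lra. Qed.

Lemma pot_dom_le x y : x <= y -> pot_dom sigma y -> pot_dom sigma x.
Proof. by move=> xy /lt_le_trans; apply; apply: pot_homo; lra. Qed.

Lemma pot_dom_le0 x : x <= 0 -> pot_dom sigma x.
Proof.
move=> x0; apply: (pot_dom_le x0).
by rewrite /pot_dom/= oppr0 pot0 invr_gt0.
Qed.

Lemma pot_inv_homo a b : pot_dom sigma b ->
  {in `[a, b] &, {homo (fun t => (sigma (- t))^-1) : x y / x <= y}}.
Proof.
move=> bD x y /itvP xI /itvP yI xy.
rewrite lef_pV2 ?posrE; first by apply: pot_homo; lra.
  by apply: pot_dom_le bD; rewrite xI.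
by apply: pot_dom_le bD; rewrite yI.
Qed.

Lemma pot_integralB a b : a <= b -> pot_dom sigma b ->
  pot_integral sigma b - pot_integral sigma a
  = \int[lebesgue_measure]_(t in `[a, b]) (sigma (- t))^-1.
Proof.
move=> leab bD; rewrite /pot_integral.
have [a0|a0] := leP 0 a; have [b0|b0] := leP 0 b; last 1 first.
- rewrite (@Rintegral_split _ _ a b 0) ?(ltW b0)//; first lra.
  exact/pot_inv_homo/pot_dom_le0.
- rewrite (@Rintegral_split _ _ 0 a b)//; first lra.
  exact: pot_inv_homo.
- lra.
- rewrite (@Rintegral_split _ _ a 0 b) ?(ltW a0)//; first lra.
  exact: pot_inv_homo.
Qed.

Lemma pot_integral_bounds a b : a <= b -> pot_dom sigma b ->
  (b - a) / sigma (- a) <= pot_integral sigma b - pot_integral sigma a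
    <= (b - a) / sigma (- b).
Proof.
move=> leab bD; rewrite pot_integralB// ![(b - a) / _]mulrC.
exact: (@Rintegral_nondecreasing_bounds _ (fun t => (sigma (- t))^-1) a b leab
  (@pot_inv_homo a b bD)).
Qed.

Section PotInverse.
Variable finv : R -> R.
Hypothesis finvP : pot_inverse sigma finv.

Let f := pot_integral sigma.

Lemma finv_dom y : pot_dom sigma (finv y). Proof. by case: finvP. Qed.
Lemma finvK y : f (finv y) = y. Proof. by case: finvP. Qed.

Lemma pot_integral0 : f 0 = 0.
Proof. by rewrite /f /pot_integral lexx set_itv1 Rintegral_set1. Qed.

(** As [pot_dom] is downward closed and f is increasing on it, f and its
inverse form a Galois connection: [le_finv] and [finv_le] are the two
halves. *)
Lemma le_finv x y : pot_dom sigma x -> f x <= y -> x <= finv y.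
Proof.
move=> xD fxy; rewrite leNgt; apply/negP => lt_x.
have /andP[+ _] := pot_integral_bounds (ltW lt_x) xD.
rewrite -/f finvK leNgt => /negP; apply.
apply: (@le_lt_trans _ _ 0); first lra.
by rewrite divr_gt0 ?subr_gt0//; exact: finv_dom.
Qed.

Lemma finv_le x y : pot_dom sigma x -> y <= f x -> finv y <= x.
Proof.
move=> xD fxy; rewrite leNgt; apply/negP => lt_x.
have /andP[+ _] := pot_integral_bounds (ltW lt_x) (finv_dom y).
rewrite -/f finvK leNgt => /negP; apply.
apply: (@le_lt_trans _ _ 0); first lra.
by rewrite divr_gt0 ?subr_gt0.
Qed.

Lemma finv_homo : {homo finv : x y / x <= y}.
Proof. by move=> x y xy; apply: (le_finv (finv_dom x)); rewrite finvK. Qed.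

Lemma finv_lt_notin x y : ~ pot_dom sigma x -> finv y < x.
Proof.
move=> xD; rewrite ltNge; apply/negP => xy; apply: xD.
exact: pot_dom_le xy (finv_dom y).
Qed.

Lemma finv_ge0 y : 0 <= y -> 0 <= finv y.
Proof. by move=> y0; apply: le_finv; rewrite ?pot_integral0//; exact: pot_dom_le0. Qed.

Lemma finv_gt0 y : 0 < y -> 0 < finv y.
Proof.
move=> y0; rewrite lt_neqAle finv_ge0 ?(ltW y0)// andbT.
by apply/eqP => e; move: y0; rewrite -(finvK y) -e pot_integral0 ltxx.
Qed.

(** The tangent bound f a <= a / sigma(-a), at a = f^-1(y). *)
Lemma mul_sigma_finv_le y : 0 <= y -> y * sigma (- finv y) <= finv y.
Proof.
move=> y0; have /andP[_] := pot_integral_bounds (finv_ge0 y0) (finv_dom y).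
by rewrite -/f finvK pot_integral0 !subr0 ler_pdivlMr//; exact: finv_dom.
Qed.

(** f^-1 grows at most like a square root when z sigma(-z) is bounded: on
[a / 2, a] the integrand is at least (a / 2) / M. *)
Lemma finv_sqr_le M y : (forall z, z * sigma (- z) <= M) -> 0 <= y ->
  finv y ^+ 2 <= 4 * M * y.
Proof.
move=> hM; rewrite le_eqVlt => /predU1P[<-|y0].
  have -> : finv 0 = 0.
    by apply/eqP; rewrite eq_le finv_ge0// finv_le// ?pot_integral0//; exact: pot_dom_le0.
  by rewrite mulr0 expr0n.
have a0 := finv_gt0 y0; set a := finv y in a0 *.
have half : a / 2 <= a by lra.
have aD2 : pot_dom sigma (a / 2) := pot_dom_le half (finv_dom y).
have /andP[+ _] := pot_integral_bounds half (finv_dom y).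
rewrite -/f finvK ler_pdivrMr//.
have : 0 <= f (a / 2).
  have /andP[+ _] := @pot_integral_bounds 0 (a / 2) (ltac:(lra)) aD2.
  rewrite -/f pot_integral0 !subr0 => /(le_trans _); apply.
  by rewrite divr_ge0 ?pot_ge0//; lra.
have := hM (a / 2); move: aD2; rewrite /pot_dom /=.
set s := sigma _ => s0 hs f0 h.
have : a / 2 <= y * s by nra.
nra.
Qed.

End PotInverse.
End PotFunction.

(** * Games as transfers of rating *)

Section Games.
Variables (R : realType) (sigma : R -> R).
Hypothesis sigma_pot : pot_function sigma.

(** Player A receives t from player B. *)
Definition transfer n (A B : 'I_n) (t : R) (r : {ffun 'I_n -> R}) :
    {ffun 'I_n -> R} :=
  [ffun i => r i + t *+ (i == A) - t *+ (i == B)].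

(** A transfer that a game may cause, oriented so that t is nonnegative: the
player who gains, A, cannot get more than by winning.  The result of the game
is forgotten; if t > 0 then A is the winner, or the lower-rated player in a
draw. *)
Definition fair_transfer n (r r' : {ffun 'I_n -> R}) : Prop :=
  exists A B t, [/\ A != B, 0 <= t, t <= sigma (- (r A - r B))
                  & r' = transfer A B t r].

Lemma play_transfer n (r : {ffun 'I_n -> R}) (g : game n) :
  play sigma r g
  = transfer (first g) (second g)
      (gain_first sigma (result g) (r (first g)) (r (second g))) r.
Proof.
case: g => A B AB o; apply/ffunP => i; rewrite !ffunE/=.
have [->|iA] := eqVneq i A; first by rewrite (negbTE AB) subr0.
case: eqVneq => [->|_]; last by rewrite addr0 subr0.
rewrite addr0; congr (_ + _).
by case: o => /=; rewrite ?opprK// -mulrN opprB.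
Qed.

Lemma play_fair n (r : {ffun 'I_n -> R}) (g : game n) :
  fair_transfer r (play sigma r g).
Proof.
rewrite play_transfer; case: g => A B AB o /=.
set t := gain_first _ _ _ _.
have s1 := potN sigma_pot (r A - r B); rewrite opprB in s1.
have s2 := pot_ge0 sigma_pot (r A - r B).
have s3 := pot_ge0 sigma_pot (r B - r A).
have [t0|/ltW t0] := leP 0 t.
  exists A, B, t; split => //; rewrite opprB.
  by move: t0; rewrite /t; case: o {t} => /=; lra.
exists B, A, (- t); split => //; rewrite ?oppr_ge0 1?eq_sym ?opprB//.
  by move: t0; rewrite /t; case: o {t} => /=; lra.
apply/ffunP => i; rewrite !ffunE !mulNrn opprK addrAC; lra.
Qed.

Lemma final_ratings_rcons n (gs : seq (game n)) g :
  final_ratings sigma (rcons gs g) = play sigma (final_ratings sigma gs) g.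
Proof. exact: foldl_rcons. Qed.

(** Every property of the ratings that is preserved by fair transfers, and may
depend on the number of games played, holds throughout. *)
Lemma final_ratings_ind n (P : nat -> {ffun 'I_n -> R} -> Prop) :
  P 0%N [ffun=> 0] ->
  (forall k r r', P k r -> fair_transfer r r' -> P k.+1 r') ->
  forall gs, P (size gs) (final_ratings sigma gs).
Proof.
move=> P0 PS; elim/last_ind => [//|gs g ih].
by rewrite size_rcons final_ratings_rcons; apply: PS ih (play_fair _ _).
Qed.

Lemma final_ratings_le_size n (gs : seq (game n)) i :
  final_ratings sigma gs i <= (size gs)%:R.
Proof.
move: gs i; apply: (@final_ratings_ind n (fun k r => forall i, r i <= k%:R)).
  by move=> i; rewrite ffunE.
move=> k r _ rk [A [B [t [AB t0 tle ->]]]] i; rewrite ffunE.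
have := pot_le1 sigma_pot (- (r A - r B)); have := rk i; rewrite -natr1.
by case: (i == A); case: (i == B); rewrite /=; lra.
Qed.

Lemma sum_final_ratings n (gs : seq (game n)) :
  \sum_i final_ratings sigma gs i = 0.
Proof.
move: gs; apply: (@final_ratings_ind n (fun=> fun r => \sum_i r i = 0)).
  by rewrite big1// => i _; rewrite ffunE.
move=> _ r _ r0 [A [B [t [_ _ _ ->]]]].
under eq_bigr do rewrite ffunE.
rewrite !big_split/= r0 sumrN add0r.
have e C : \sum_i t *+ (i == C) = t.
  by rewrite (bigD1 C)//= eqxx big1 ?addr0// => i /negbTE ->.
by rewrite !e subrr.
Qed.

Lemma le_max_rating n (gs : seq (game n)) i :
  final_ratings sigma gs i <= max_rating sigma n (size gs).
Proof.
apply: ub_le_sup; last by exists gs, i.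
by exists (size gs)%:R => _ [gs' [j [<- ->]]]; exact: final_ratings_le_size.
Qed.

(** Player 0 beats player 1. *)
Definition game01 n (n2 : (2 <= n)%N) : game n :=
  @Game n (Ordinal (ltnW n2)) (Ordinal n2) isT FirstWins.

Lemma max_rating_le n k c : (2 <= n)%N ->
  (forall (gs : seq (game n)) i, size gs = k -> final_ratings sigma gs i <= c) ->
  max_rating sigma n k <= c.
Proof.
move=> n2 hc; apply: ge_sup; last by move=> _ [gs [i [sgs ->]]]; exact: hc.
pose gs := nseq k (game01 n2).
by exists (final_ratings sigma gs (Ordinal n2)), gs, (Ordinal n2); rewrite size_nseq.
Qed.
End Games.
(** * Two players *)

Section TwoPlayers.
Variables (R : realType) (sigma finv : R -> R).
Hypotheses (sigma_pot : pot_function sigma) (finvP : pot_inverse sigma finv).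

Let f := pot_integral sigma.

(** Here x is the lead of the player who wins. *)
Lemma finv_double_win x y : finv y <= x -> finv (y + 2) <= x + 2 * sigma (- x).
Proof.
move=> yx; set x' := x + _.
have xx' : x <= x' by rewrite lerDl mulr_ge0// pot_ge0.
have [x'D|x'D] := pselect (pot_dom sigma x'); last first.
  exact/ltW/(finv_lt_notin sigma_pot finvP).
have xD := pot_dom_le sigma_pot xx' x'D.
apply: (finv_le sigma_pot finvP x'D); rewrite -/f.
have /andP[+ _] := pot_integral_bounds sigma_pot xx' x'D.
have /andP[+ _] := pot_integral_bounds sigma_pot yx xD.
have -> : (x' - x) / sigma (- x) = 2.
  by rewrite /x' addrAC subrr add0r mulfK// gt_eqF.
have : 0 <= (x - finv y) / sigma (- finv y).
  by rewrite divr_ge0 ?subr_ge0// ltW//; exact: (finv_dom finvP).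
rewrite (finvK finvP) -/f; lra.
Qed.

(** Here x is the lead, possibly negative, of the player who gains t.  As
2 t <= 2 <= 5, the interval from x - 5 to x + 2 t - 5 lies below x, where
the integrand is at most 1 / sigma(-x). *)
Lemma finv_double_gain x y t : 0 <= t -> t <= sigma (- x) ->
  x - 5 <= finv y -> x + 2 * t - 5 <= finv (y + 2).
Proof.
move=> t0 tx xy; set b := x + 2 * t - 5.
have t1 := le_trans tx (pot_le1 sigma_pot (- x)).
have [t00|tn0] := eqVneq t 0.
  apply: le_trans (finv_homo sigma_pot finvP (_ : y <= y + 2)); last lra.
  by rewrite /b t00; lra.
have t_gt0 : 0 < t by rewrite lt_neqAle eq_sym tn0.
have xD : pot_dom sigma x by exact: lt_le_trans tx.
have bx : b <= x by rewrite /b; lra.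
have xb : x - 5 <= b by rewrite /b; lra.
have bD := pot_dom_le sigma_pot bx xD.
apply: (le_finv sigma_pot finvP bD); rewrite -/f.
have cD := pot_dom_le sigma_pot xb bD.
have /andP[_] := pot_integral_bounds sigma_pot xb bD.
have /andP[+ _] := pot_integral_bounds sigma_pot xy (finv_dom finvP y).
have : 0 <= (finv y - (x - 5)) / sigma (- (x - 5)).
  by rewrite divr_ge0 ?subr_ge0// ltW.
rewrite (finvK finvP) -/f => h1 h2 h3.
have : (b - (x - 5)) / sigma (- b) <= 2.
  rewrite ler_pdivrMr//.
  have : sigma (- x) <= sigma (- b) by apply: pot_homo => //; lra.
  by rewrite /b; lra.
lra.
Qed.

Lemma ord2_cases (A B i : 'I_2) : A != B -> (i == A) = (i != B).
Proof.
by case: A B i => [[|[|A]] hA] [[|[|B]] hB] [[|[|i]] hi]; rewrite -!val_eqE.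
Qed.

Lemma two_player_lower k : 2^-1 * finv (2 * k%:R) <= max_rating sigma 2 k.
Proof.
pose g0 := game01 (leqnn 2); pose A := first g0; pose B := second g0.
suff [gs [<- hA _]] : exists gs, [/\ size gs = k,
    finv (2 * k%:R) <= 2 * final_ratings sigma gs A &
    final_ratings sigma gs B = - final_ratings sigma gs A].
  by apply: le_trans (le_max_rating sigma_pot gs A); lra.
elim: k => [|k [gs [sz ih eAB]]].
  exists [::]; rewrite /final_ratings/= !ffunE oppr0; split => //.
  rewrite !mulr0; apply: (finv_le sigma_pot finvP); first exact: pot_dom_le0.
  by rewrite pot_integral0.
exists (rcons gs g0); rewrite size_rcons sz final_ratings_rcons play_transfer.
rewrite -/A -/B !ffunE !eqxx/= eAB; split => //; last lra.
have := finv_double_win ih; rewrite -[k.+1%:R]natr1 mulrDr mulr1.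
set rA := final_ratings sigma gs A.
by congr (_ <= _); rewrite (_ : - (2 * rA) = - rA - rA); ring.
Qed.

Lemma two_player_upper k :
  max_rating sigma 2 k <= 2^-1 * finv (2 * k%:R - 2) + 5 / 2.
Proof.
apply: max_rating_le => // gs i <-.
suff : (forall i j : 'I_2, i != j ->
      final_ratings sigma gs j = - final_ratings sigma gs i) /\
    forall i, 2 * final_ratings sigma gs i - 5 <= finv (2 * (size gs)%:R - 2).
  by move=> [_ /(_ i) hi]; lra.
move: gs {i}; apply: (@final_ratings_ind _ _ sigma_pot 2 (fun k r =>
  (forall i j, i != j -> r j = - r i) /\
  forall i, 2 * r i - 5 <= finv (2 * k%:R - 2))).
  split=> [i j _|i]; first by rewrite !ffunE oppr0.
  rewrite ffunE mulr0 add0r.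
  have dom5 : pot_dom sigma (- 5) by apply: (pot_dom_le0 sigma_pot); lra.
  apply: (le_finv sigma_pot finvP dom5).
  have le50 : - 5 <= 0 :> R by lra.
  have /andP[+ _] :=
    pot_integral_bounds sigma_pot le50 (pot_dom_le0 sigma_pot (lexx 0)).
  rewrite pot_integral0 opprK.
  have : 5 <= 5 / sigma 5.
    rewrite ler_peMr// invf_ge1 ?pot_le1//.
    by move: dom5; rewrite /pot_dom/= opprK.
  lra.
move=> k' r r' [rN rk] [A [B [t [AB t0 tle ->]]]].
have rB := rN _ _ AB; rewrite rB opprK -mulr2n -mulr_natl in tle.
have {}rk' i : 2 * r i - 5 <= finv (2 * k'.+1%:R - 2).
  apply: le_trans (rk i) _; apply: (finv_homo sigma_pot finvP).
  by rewrite -[k'.+1%:R]natr1; lra.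
split=> i.
  move=> j ij; rewrite !ffunE (rN _ _ ij).
  have := ord2_cases i AB; have := ord2_cases j AB; have := ord2_cases A ij.
  rewrite ![A == _]eq_sym.
  case: (i == A); case: (j == A); case: (i == B); case: (j == B) => //= _ _ _; lra.
rewrite ffunE (ord2_cases i AB); case: eqVneq => [->|iB] /=; first by have := rk' B; lra.
have -> : i = A by apply/eqP; rewrite (ord2_cases _ AB).
have := finv_double_gain t0 tle (rk A).
rewrite -[k'.+1%:R]natr1 (_ : 2 * k'%:R - 2 + 2 = 2 * (k'%:R + 1) - 2); last by ring.
lra.
Qed.
End TwoPlayers.

(** * The barrier argument *)

Section Barrier.
Variables (R : realType) (sigma : R -> R) (n : nat).
Hypothesis sigma_pot : pot_function sigma.

Lemma sum_transfer (A B : 'I_n) (t : R) (r : {ffun 'I_n -> R}) (X : {set 'I_n}) :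
  \sum_(i in X) transfer A B t r i
  = \sum_(i in X) r i + t *+ (A \in X) - t *+ (B \in X).
Proof.
under eq_bigr do rewrite ffunE.
rewrite !big_split/= sumrN.
have e C : \sum_(i in X) t *+ (i == C) = t *+ (C \in X).
  have [CX|CX] := boolP (C \in X).
    by rewrite (bigD1 C)//= eqxx big1 ?addr0// => i /andP[_ /negbTE ->].
  by rewrite big1// => i iX; case: eqVneq => [E|//]; rewrite -E iX in CX.
by rewrite !e.
Qed.

(** The barrier P: it takes the values 0 at 0 and b m at m, and its second
difference is -G. *)
Definition parabola (m : nat) (b G : R) (j : nat) : R :=
  b * j%:R + G / 2 * (j%:R * (m%:R - j%:R)).

(** The maximum principle.  The hypothesis on sets of m players gives the bound
at the right end of the parabola, at every moment of the play. *)
Lemma barrier (m : nat) (b G : R) (gs : seq (game n)) :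
  0 <= b -> 0 <= G ->
  (forall gs' (X : {set 'I_n}), (size gs' <= size gs)%N -> #|X| = m ->
     \sum_(i in X) final_ratings sigma gs' i <= b * m%:R) ->
  forall X : {set 'I_n}, (#|X| <= m)%N ->
    \sum_(i in X) final_ratings sigma gs i
    <= parabola m b G #|X| + (size gs)%:R * sigma (2 - G).
Proof.
move=> b0 G0; elim/last_ind: gs => [|gs g ih] hm X Xm.
  rewrite /final_ratings/= mul0r addr0 big1 => [|i _]; last by rewrite ffunE.
  by rewrite addr_ge0 ?mulr_ge0 ?subr_ge0 ?ler_nat//; lra.
have {}ih : forall X : {set 'I_n}, (#|X| <= m)%N ->
    \sum_(i in X) final_ratings sigma gs i
    <= parabola m b G #|X| + (size gs)%:R * sigma (2 - G).
  by apply: ih => gs' Y sz; apply: hm; rewrite size_rcons (leq_trans sz).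
pose r := final_ratings sigma gs; pose r' := final_ratings sigma (rcons gs g).
pose D (Y : {set 'I_n}) := \sum_(i in Y) r' i - parabola m b G #|Y|.
have eps0 := pot_ge0 sigma_pot (2 - G).
have k0 := ler0n R (size gs).
suff : D X <= (size gs).+1%:R * sigma (2 - G).
  by rewrite size_rcons -/r' /D; lra.
(* Y maximizes the excess of the sum of the new ratings over the barrier. *)
have [Y Ym Ymax] := @arg_maxP _ R _ X (fun Y : {set 'I_n} => (#|Y| <= m)%N) D Xm.
apply: le_trans (Ymax X Xm) _.
rewrite -[(size gs).+1%:R]natr1 mulrDl mul1r.
have := play_fair sigma_pot r g; rewrite -final_ratings_rcons -/r'.
move=> [A [B [t [AB t0 tle r'E]]]].
have ihY := ih Y Ym; rewrite -/r in ihY.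
have t1 := le_trans tle (pot_le1 sigma_pot _).
(* Only a set containing A but not B can have a larger sum than before. *)
have [/andP[AY BY]|nAB] := boolP ((A \in Y) && (B \notin Y)); last first.
  have : \sum_(i in Y) r' i <= \sum_(i in Y) r i.
    rewrite r'E sum_transfer.
    by move: nAB; case: (A \in Y); case: (B \in Y) => //=; lra.
  by rewrite /D; lra.
have [Y_m|Y_m] := eqVneq #|Y| m.
  have := hm (rcons gs g) Y (leqnn _) Y_m; rewrite -/r' /D /parabola Y_m subrr.
  have : 0 <= (size gs)%:R * sigma (2 - G) by exact: mulr_ge0.
  lra.
have Y_lt : (#|Y| < m)%N by rewrite ltn_neqAle Y_m.
have cD1 := cardsD1 A Y; rewrite AY add1n in cD1.
have cU1 := cardsU1 B Y; rewrite BY add1n in cU1.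
have := Ymax (Y :\ A) (leq_trans (subset_leq_card (subD1set Y A)) Ym).
have := Ymax (B |: Y); rewrite cU1 => /(_ Y_lt).
(* Compare Y with Y minus A and with Y plus B. *)
pose j : R := #|Y :\ A|%:R.
have j1 : #|Y :\ A|.+1%:R = j + 1 by rewrite natr1.
have j2 : #|Y :\ A|.+2%:R = j + 2 by rewrite -[LHS]natr1 j1; ring.
rewrite /D cU1 cD1 big_setU1//= (big_setD1 A AY)/= /parabola j1 j2 -/j.
set S := \sum_(i in _) _ => hB hA.
have gap : G <= r' A - r' B by nra.
have : t <= sigma (2 - G).
  apply: le_trans tle _; apply: pot_homo => //.
  move: gap; rewrite r'E !ffunE !eqxx (negbTE AB) eq_sym (negbTE AB)/=; lra.
move: ihY; rewrite (big_setD1 A AY)/= cD1 /parabola j1.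
have -> : S = \sum_(i in Y :\ A) r i.
  by rewrite /S r'E sum_transfer !inE eqxx (negbTE BY) andbF/= addr0 subr0.
have -> : r' A = r A + t by rewrite r'E ffunE eqxx (negbTE AB) subr0.
lra.
Qed.

Lemma sum_sqr_final_ratings (M : R) (gs : seq (game n)) :
  (forall z, z * sigma (- z) <= M) ->
  \sum_i final_ratings sigma gs i ^+ 2 <= (size gs)%:R * (2 * M + 2).
Proof.
move=> hM; have M0 : 0 <= M by have := hM 0; rewrite mul0r.
move: gs; apply: (@final_ratings_ind _ _ sigma_pot n
  (fun k r => \sum_i r i ^+ 2 <= k%:R * (2 * M + 2))).
  by rewrite mul0r big1// => i _; rewrite ffunE expr0n.
move=> k r _ rk [A [B [t [AB t0 tle ->]]]].
have t1 := le_trans tle (pot_le1 sigma_pot _).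
have BA : B != A by rewrite eq_sym.
move: rk; rewrite (bigD1 A)//= (bigD1 B)//= => rk.
rewrite (bigD1 A)//= (bigD1 B)//= !ffunE !eqxx (negbTE AB) (negbTE BA)/=.
rewrite (eq_bigr (fun i => r i ^+ 2)); last first.
  by move=> i /andP[/negbTE iA /negbTE iB]; rewrite ffunE iA iB addr0 subr0.
move: rk; set S := \sum_(i | _) _ => rk.
have dt : t * (r A - r B) <= M.
  have [d0|d0] := leP 0 (r A - r B); last by apply: le_trans M0; nra.
  by apply: le_trans (hM (r A - r B)); rewrite mulrC ler_wpM2l.
rewrite -[k.+1%:R]natr1; nra.
Qed.

End Barrier.
(** * Spreading the ratings by chip-firing *)

Section ChipFiring.
Variables (R : realType) (sigma : R -> R).
Hypothesis sigma_pot : pot_function sigma.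

Definition flip_outcome (o : outcome) : outcome :=
  match o with FirstWins => SecondWins | SecondWins => FirstWins | Draw => Draw end.

(** The same game with the opposite result; it turns opposite ratings into
opposite ratings. *)
Definition flip_game n (g : game n) : game n :=
  Game (first_neq_second g) (flip_outcome (result g)).

Lemma final_ratings_flip n (gs : seq (game n)) i :
  final_ratings sigma (map (@flip_game n) gs) i = - final_ratings sigma gs i.
Proof.
elim/last_ind: gs i => [|gs g ih] i; first by rewrite /final_ratings/= !ffunE oppr0.
rewrite map_rcons !final_ratings_rcons !play_transfer !ffunE/= !ih.
set A := first g; set B := second g.
have -> : gain_first sigma (flip_outcome (result g))
    (- final_ratings sigma gs A) (- final_ratings sigma gs B)
  = - gain_first sigma (result g) (final_ratings sigma gs A) (final_ratings sigma gs B).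
  by case: (result g) => /=; rewrite !opprK ![- _ + _]addrC//; ring.
by case: (i == A); case: (i == B) => /=; ring.
Qed.

(** Any player may keep on winning, so that ratings reached early are not
lost. *)
Lemma extend_winning n (gs : seq (game n)) (i : 'I_n) m : (2 <= n)%N ->
  exists gs', size gs' = (size gs + m)%N /\
    final_ratings sigma gs i <= final_ratings sigma gs' i.
Proof.
move=> n2; have [j ij] : exists j : 'I_n, i != j.
  have [e|e] := eqVneq i (Ordinal n2); last by exists (Ordinal n2).
  by exists (Ordinal (ltnW n2)); rewrite e.
elim: m => [|m [gs' [sz ih]]]; first by exists gs; rewrite addn0.
exists (rcons gs' (Game ij FirstWins)); rewrite size_rcons sz addnS; split => //.
rewrite final_ratings_rcons play_transfer ffunE/= eqxx (negbTE ij) subr0.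
by apply: le_trans ih _; rewrite lerDl; exact: (pot_ge0 sigma_pot).
Qed.

Lemma le_max_rating_extend n k (gs : seq (game n)) (i : 'I_n) : (2 <= n)%N ->
  (size gs <= k)%N -> final_ratings sigma gs i <= max_rating sigma n k.
Proof.
move=> n2 gsk; have [gs' [sz h]] := extend_winning gs i (k - size gs) n2.
apply: le_trans h _; move: sz; rewrite subnKC// => <-.
exact: (le_max_rating sigma_pot).
Qed.

(** The ratings whose doubles are the integers z. *)
Definition half_ratings n (z : {ffun 'I_n -> int}) : {ffun 'I_n -> R} :=
  [ffun i => (z i)%:~R / 2].

(** The first 2 l + 2 players share the 2 l + 1 values from -l to l. *)
Lemma pigeonhole_ratings n l (z : {ffun 'I_n -> int}) : (l.*2.+2 <= n)%N ->
  (forall i, `|z i| <= l%:Z) ->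
  exists A B : 'I_n, [/\ A != B, (A < l.*2.+2)%N, (B < l.*2.+2)%N & z A = z B].
Proof.
move=> ln zl.
pose w := widen_ord ln : 'I_l.*2.+2 -> 'I_n.
pose f i : 'I_l.*2.+1 := inord (absz (z (w i) + l%:Z)).
have : ~~ injectiveb f.
  by apply/negP => /injectiveP /leq_card; rewrite !card_ord ltnn.
move=> /injectivePn[A [B AB fAB]].
exists (w A), (w B); split.
- by apply: contra_neq AB => wAB; apply/val_inj; exact: (congr1 val wAB).
- exact: (ltn_ord A).
- exact: (ltn_ord B).
have zA := zl (w A); have zB := zl (w B).
by move: fAB => /(congr1 val); rewrite /f /= !inordK; lia.
Qed.

(** Chip-firing among the first 2 l + 2 players: either some doubled rating
exceeds l in absolute value after at most j games, or the sum of squares has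
increased by 2 in each of j games.  The other players keep the rating 0. *)
Lemma chip_firing n l j : (l.*2.+2 <= n)%N ->
  exists (gs : seq (game n)) (z : {ffun 'I_n -> int}),
    [/\ (size gs <= j)%N, final_ratings sigma gs = half_ratings z &
      (exists i, l%:Z < `|z i|) \/
      ((\sum_i z i ^+ 2 = (j.*2)%:Z) /\
       forall i : 'I_n, (l.*2.+2 <= i)%N -> z i = 0)].
Proof.
move=> ln; elim: j => [|j [gs [z [sz e alt]]]].
  exists [::], [ffun=> 0]; split=> //.
    by apply/ffunP => i; rewrite !ffunE mul0r.
  by right; split=> [|i _]; rewrite ?ffunE// big1// => i _; rewrite ffunE.
have [[i li]|small] := pselect (exists i, l%:Z < `|z i|).
  by exists gs, z; split; [exact: leqW|exact: e|left; exists i].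
have zl i : `|z i| <= l%:Z by rewrite leNgt; apply/negP => li; apply: small; exists i.
case: alt => // -[z2 z0].
have [A [B [AB Al Bl zAB]]] := pigeonhole_ratings ln zl.
have BA : B != A by rewrite eq_sym.
exists (rcons gs (Game AB FirstWins)), [ffun i => z i + (i == A)%:Z - (i == B)%:Z].
split; first by rewrite size_rcons.
  rewrite final_ratings_rcons play_transfer e; apply/ffunP => i; rewrite !ffunE/=.
  rewrite zAB subrr (pot0 sigma_pot) !rmorphB !rmorphD/= .
  by case: (i == A); case: (i == B); rewrite /=; ring.
right; split; last first.
  move=> i li; rewrite ffunE z0//.
  have [iA|_] := eqVneq i A; first by move: Al; rewrite -iA ltnNge li.
  by have [iB|_] := eqVneq i B; first by move: Bl; rewrite -iB ltnNge li.
move: z2; rewrite (bigD1 A)//= (bigD1 B)//= => z2.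
rewrite (bigD1 A)//= (bigD1 B)//= !ffunE !eqxx (negbTE AB) (negbTE BA)/=.
rewrite (eq_bigr (fun i => z i ^+ 2)); last first.
  by move=> i /andP[/negbTE iA /negbTE iB]; rewrite ffunE iA iB addr0 subr0.
move: z2; set S := \sum_(i | _) _; rewrite zAB; nia.
Qed.

Lemma max_rating_ge n k l : (2 * l <= n)%N -> (2 <= n)%N -> (l ^ 3 <= k)%N ->
  l%:R / 2 <= max_rating sigma n k.
Proof.
case: l => [|l] ln n2 lk.
  have := @le_max_rating_extend n k [::] (Ordinal n2) n2 (leq0n k).
  by rewrite /final_ratings/= ffunE mul0r.
have {}ln : (l.*2.+2 <= n)%N by lia.
have [gs [z [sz e alt]]] := chip_firing (l.+1 ^ 3) ln.
suff [i li] : exists i, l%:Z < `|z i|.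
  have half : l.+1%:R / 2 <= `|final_ratings sigma gs i|.
    have half_norm : `|2^-1| = 2^-1 :> R by rewrite ger0_norm ?invr_ge0.
    rewrite e ffunE normrM half_norm.
    by rewrite ler_pM2r ?invr_gt0// -intr_norm (_ : l.+1%:R = l.+1%:Z%:~R)// ler_int; lia.
  apply: le_trans half _; have [r0|r0] := leP 0 (final_ratings sigma gs i).
    by rewrite ger0_norm//; apply: le_max_rating_extend => //; lia.
  rewrite ltr0_norm// -final_ratings_flip.
  by apply: le_max_rating_extend; rewrite ?size_map//; lia.
case: alt => // -[z2 z0].
apply/not_existsP => small.
have zl i : `|z i| <= l%:Z by rewrite leNgt; apply/negP => /small.
have : \sum_i z i ^+ 2 <= \sum_(i < n | (i < l.*2.+2)%N) (l%:Z ^+ 2).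
  rewrite [leRHS]big_mkcond; apply: ler_sum => i _; case: ltnP => [_|/z0 ->]; last by [].
  by have := zl i; nia.
rewrite z2 sumr_const.
have -> : #|[pred i : 'I_n | (i < l.*2.+2)%N]| = l.*2.+2.
  rewrite -sum1_card (big_ord_narrow ln).
  by rewrite sum1_card card_ord.
nia.
Qed.
End ChipFiring.

(** * Upper bounds for many players *)

Section UpperBounds.
Variables (R : realType) (sigma finv : R -> R).
Hypotheses (sigma_pot : pot_function sigma) (finvP : pot_inverse sigma finv).

Lemma max_rating_le_barrier n k m (b G : R) : (2 <= n)%N -> (0 < m)%N ->
  0 <= b -> 0 <= G ->
  (forall (gs : seq (game n)) (X : {set 'I_n}), (size gs <= k)%N -> #|X| = m ->
     \sum_(i in X) final_ratings sigma gs i <= b * m%:R) ->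
  max_rating sigma n k <= b + G / 2 * (m%:R - 1) + k%:R * sigma (2 - G).
Proof.
move=> n2 m0 b0 G0 hm; apply: max_rating_le => // gs i sz.
rewrite -sz in hm *.
have := barrier sigma_pot b0 G0 hm (X := [set i]).
by rewrite cards1 big_set1 /parabola !mulr1 mul1r => /(_ m0).
Qed.

(** If there are no more players than games. *)
Lemma max_rating_le_players n k : (2 <= n)%N -> (n <= k)%N ->
  max_rating sigma n k <= (3 / 2 + 1 / finv 1) * n%:R * finv (k%:R / n%:R).
Proof.
move=> n2 nk; set a := finv (k%:R / n%:R).
have n0 : 0 < n%:R :> R by rewrite ltr0n; lia.
have kn1 : 1 <= k%:R / n%:R :> R by rewrite ler_pdivlMr// mul1r ler_nat.
have a0_gt0 : 0 < finv 1 by exact: (finv_gt0 sigma_pot finvP).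
have a0a : finv 1 <= a by exact: (finv_homo sigma_pot finvP).
have ainv : 1 <= 1 / finv 1 * a by rewrite mul1r mulrC ler_pdivlMr// mul1r.
apply: le_trans (@max_rating_le_barrier n k n 0 (a + 2) n2 (ltnW n2) (lexx 0) _ _) _.
- lra.
- move=> gs X _ Xn; rewrite mul0r.
  have -> : X = [set: 'I_n]%SET.
    by apply/eqP; rewrite eqEcard finset.subsetT cardsT card_ord Xn leqnn.
  by under eq_bigl do rewrite inE; rewrite sum_final_ratings.
have -> : 2 - (a + 2) = - a by ring.
have : k%:R * sigma (- a) <= n%:R * a.
  have := mul_sigma_finv_le sigma_pot finvP (le_trans ler01 kn1).
  by rewrite -/a mulrAC ler_pdivrMr// [a * _]mulrC.
have : n%:R * 1 <= n%:R * (1 / finv 1 * a) by rewrite ler_pM2l.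
nra.
Qed.

(** A weighted form of the Cauchy-Schwarz inequality; the best b satisfies
[b ^+ 2 * #|X|%:R = \sum_i r i ^+ 2]. *)
Lemma sum_le_sum_sqr (n : nat) (r : 'I_n -> R) (X : {set 'I_n}) (b : R) : 0 < b ->
  \sum_(i in X) r i <= ((\sum_i r i ^+ 2) / b + b * #|X|%:R) / 2.
Proof.
move=> b0; have h i : r i <= (r i ^+ 2 / b + b) / 2.
  have : 0 <= (r i - b) ^+ 2 / b by rewrite divr_ge0 ?sqr_ge0// ltW.
  have -> : (r i - b) ^+ 2 / b = r i ^+ 2 / b + b - 2 * r i by field; rewrite gt_eqF.
  lra.
apply: le_trans (ler_sum _ (fun i _ => h i)) _.
rewrite -mulr_suml big_split/= sumr_const -mulr_suml [b * _]mulr_natr.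
rewrite ler_pM2r ?invr_gt0// lerD2r ler_pM2r ?invr_gt0//.
rewrite [leRHS](bigID (mem X))/= lerDl; apply: sumr_ge0 => i _; exact: sqr_ge0.
Qed.

(** Here y is the cube root of k f^-1(k), and the number of players is
arbitrary. *)
Lemma max_rating_le_games M n k y : (forall z, z * sigma (- z) <= M) ->
  (2 <= n)%N -> (0 < k)%N -> 0 < y -> y ^+ 3 = k%:R * finv k%:R ->
  max_rating sigma n k <= (6 * M + 5 + 1 / finv 1) * y.
Proof.
move=> hM n2 k_gt0 y0 y3; set a := finv k%:R in y3.
have M0 : 0 <= M by have := hM 0; rewrite mul0r.
have k0 : 0 < k%:R :> R by rewrite ltr0n.
have a0_gt0 : 0 < finv 1 by exact: (finv_gt0 sigma_pot finvP).
have a0a : finv 1 <= a by apply: (finv_homo sigma_pot finvP); rewrite ler1n.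
have a0 : 0 < a by exact: lt_le_trans a0a.
have ainv : 1 / a <= 1 / finv 1 by rewrite !mul1r lef_pV2.
have x0 : 0 <= y / a by rewrite divr_ge0 ?ltW.
(* With a = f^-1(k) one has y / a = (k / a^2)^(1/3), and m - 1 is
   this number rounded down. *)
have /andP[mx xm] := truncn_itv x0; set m := (Num.truncn (y / a)).+1 in xm.
have mE : (m%:R - 1 : R) = (Num.truncn (y / a))%:R by rewrite /m -natr1 addrK.
(* b is such that (2 M + 2) k <= b^2 m, because k <= y^2 m. *)
pose b := (2 * M + 3) * y.
have b0 : 0 < b by rewrite mulr_gt0//; lra.
apply: le_trans (@max_rating_le_barrier n k m b (a + 2) n2 isT (ltW b0) _ _) _.
- lra.
- move=> gs X gsk Xm; apply: le_trans (sum_le_sum_sqr _ X b0) _.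
  have sq : \sum_i final_ratings sigma gs i ^+ 2 <= k%:R * (2 * M + 2).
    apply: le_trans (sum_sqr_final_ratings sigma_pot gs hM) _.
    by rewrite ler_wpM2r ?ler_nat//; lra.
  suff : (\sum_i final_ratings sigma gs i ^+ 2) / b <= b * m%:R by rewrite Xm; lra.
  rewrite ler_pdivrMr//; apply: le_trans sq _.
  have ma : y <= m%:R * a by rewrite -ler_pdivrMr// ltW.
  have : y ^+ 2 * y <= y ^+ 2 * (m%:R * a) by rewrite ler_pM2l// exprn_gt0.
  rewrite -exprSr y3 mulrA ler_pM2r// => ky.
  have -> : b * m%:R * b = (2 * M + 3) ^+ 2 * (y ^+ 2 * m%:R) by rewrite /b; ring.
  nra.
have -> : 2 - (a + 2) = - a by ring.
have ka : k%:R * sigma (- a) <= a := mul_sigma_finv_le sigma_pot finvP (ltW k0).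
have ay : a <= (4 * M + 1) * y.
  have My0 : 0 <= (4 * M + 1) * y by rewrite mulr_ge0 ?(ltW y0)//; lra.
  rewrite -(@ler_pXn2r _ 3) ?nnegrE ?(ltW a0)//.
  have a2 : a ^+ 2 <= 4 * M * k%:R := finv_sqr_le sigma_pot finvP hM (ltW k0).
  rewrite exprMn y3 [a ^+ 3]exprSr.
  apply: (@le_trans _ _ (4 * M * k%:R * a)); first by rewrite ler_pM2r.
  rewrite -mulrA ler_pM2r ?mulr_gt0//.
  have : 1 * (4 * M + 1) <= (4 * M + 1) ^+ 2 * (4 * M + 1).
    by rewrite ler_pM2r ?exprn_ege1//; lra.
  by rewrite -exprSr; lra.
have mid : (a + 2) / 2 * (m%:R - 1) <= y / 2 + 1 / finv 1 * y.
  rewrite mE; apply: (@le_trans _ _ ((a + 2) / 2 * (y / a))).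
    by rewrite ler_pM2l//; lra.
  have -> : (a + 2) / 2 * (y / a) = y / 2 + 1 / a * y by field; rewrite gt_eqF.
  by rewrite lerD2l ler_pM2r.
rewrite /b; nra.
Qed.

End UpperBounds.

(** * Asymptotics *)

Lemma cbrtK (R : realType) (x : R) : 0 <= x -> (x `^ 3^-1) ^+ 3 = x.
Proof. by move=> x0; rewrite -powR_mulrn ?powR_ge0// -powRrM mulVf// powRr1. Qed.

Theorem theorem1p1 (R : realType) (sigma finv : R -> R)
    (sigma_pot : pot_function sigma) (finvP : pot_inverse sigma finv) :
  (forall k : nat,
     2^-1 * finv (2 * k%:R) <= max_rating sigma 2 k /\
     max_rating sigma 2 k <= 2^-1 * finv (2 * k%:R - 2) + 5 / 2) /\
  (has_ubound (range (fun z : R => z * sigma (- z))) ->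
   forall h : nat -> nat, (forall k, (2 <= h k)%N) ->
     ((fun k => (h k)%:R : R) =Omega_\oo (fun k => k%:R `^ 3^-1 : R) ->
      exists C1 C2 : R, [/\ 0 < C1, 0 < C2 &
        \forall k \near \oo,
          C1 * k%:R `^ 3^-1 <= max_rating sigma (h k) k /\
          max_rating sigma (h k) k
            <= C2 * k%:R `^ 3^-1 * finv k%:R `^ 3^-1]) /\
     ((fun k => (h k)%:R : R) =o_\oo (fun k => k%:R `^ 3^-1 : R) ->
      exists C1 C2 : R, [/\ 0 < C1, 0 < C2 &
        \forall k \near \oo,
          C1 * (h k)%:R <= max_rating sigma (h k) k /\
          max_rating sigma (h k) k
            <= C2 * (h k)%:R * finv (k%:R / (h k)%:R)])).
Proof.
split=> [k|].
  by split; [exact: (two_player_lower sigma_pot finvP)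
            |exact: (two_player_upper sigma_pot finvP)].
move=> [M /= hM] h h2.
have {}hM z : z * sigma (- z) <= M by apply: hM; exists z.
have M0 : 0 <= M by have := hM 0; rewrite mul0r.
have a0_gt0 : 0 < finv 1 by exact: (finv_gt0 sigma_pot finvP).
have a0V_gt0 : 0 < 1 / finv 1 by rewrite divr_gt0.
split.
- rewrite eqOmegaE qualifE => /asboolP[K K0 hK].
  (* With l about c k^(1/3), c <= 1 gives l^3 <= k and c <= K / 2 gives
     2 l <= h k. *)
  pose c := Num.min 1 (K / 2).
  have c1 : c <= 1 by rewrite ge_min lexx.
  have cK : c <= K / 2 by rewrite ge_min lexx orbT.
  have c0 : 0 < c by rewrite lt_min ltr01 divr_gt0.
  exists (c / 4), (6 * M + 5 + 1 / finv 1); split; [lra|lra|].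
  near=> k.
  have k0 : (0 < k)%N by near: k; exact: nbhs_infty_gt.
  have kR0 : 0 < k%:R :> R by rewrite ltr0n.
  have hq : K * `|k%:R `^ 3^-1| <= `|(h k)%:R : R| by near: k.
  have k_large : (2 / c) ^+ 3 <= k%:R :> R by near: k; exact: nbhs_infty_ger.
  move: hq; set q := k%:R `^ 3^-1 => hq.
  have q0 : 0 < q by exact: powR_gt0.
  have q3 : q ^+ 3 = k%:R by exact: cbrtK.
  rewrite !ger0_norm// ?(ltW q0)// in hq.
  split.
    have cq2 : 2 <= c * q.
      rewrite mulrC -ler_pdivrMr// -(@ler_pXn2r _ 3) ?nnegrE ?(ltW q0)// ?q3//.
      by rewrite divr_ge0// ltW.
    have /andP[l1 l2] := truncn_itv (le_trans (ler0n R 2) cq2).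
    set l := Num.truncn (c * q) in l1 l2.
    have lq : l%:R <= q by apply: le_trans l1 _; rewrite ger_pMl.
    apply: (@le_trans _ _ (l%:R / 2)).
      by move: l2; rewrite -natr1; lra.
    apply: (max_rating_ge sigma_pot) => //.
      rewrite -(ler_nat R) natrM; apply: le_trans hq; nra.
    by rewrite -(ler_nat R) natrX -q3 ler_pXn2r ?nnegrE ?(ltW q0).
  rewrite -mulrA; apply: (max_rating_le_games sigma_pot finvP hM) => //.
    by rewrite mulr_gt0// powR_gt0//; exact: (finv_gt0 sigma_pot finvP).
  by rewrite exprMn q3 cbrtK//; exact/ltW/(finv_gt0 sigma_pot finvP).
- move=> /eqoP/(_ 1 ltr01) ho.
  exists 6^-1, (3 / 2 + 1 / finv 1); split; [by rewrite invr_gt0|lra|].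
  near=> k.
  have hq : (h k)%:R <= k%:R `^ 3^-1 :> R.
    have : `|(h k)%:R : R| <= 1 * `|k%:R `^ 3^-1| by near: k.
    by rewrite mul1r !ger0_norm// powR_ge0.
  have h3 : ((h k) ^ 3 <= k)%N.
    by rewrite -(ler_nat R) natrX -[leRHS]cbrtK// ler_pXn2r ?nnegrE ?powR_ge0.
  have := h2 k; set n := h k in hq h3 * => n2.
  split; last first.
    apply: (max_rating_le_players sigma_pot finvP) => //.
    by apply: leq_trans h3; rewrite -[leqLHS]expn1 leq_exp2l.
  (* As n >= 2, half of n rounded down is at least n / 3. *)
  apply: (@le_trans _ _ (n./2%:R / 2)).
    have : n%:R <= 3 * n./2%:R :> R by rewrite -natrM ler_nat; lia.
    lra.
  apply: (max_rating_ge sigma_pot) => //; first by lia.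
  by apply: leq_trans h3; rewrite leq_exp2r//; lia.
Unshelve. all: by end_near.
Qed.
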